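(* Let $n,m\ge1$, let $f$ be the flux, $A\in\mathfrak N$, and fix an initial datum $(\rho_{1,0},\dots,\rho_{n+m,0})\in[0,1]^{n+m}$. Let $\mathcal H\subseteq\{1,\dots,n+m\}$ be a set of cardinality $h$ with $0\le h\le n-1$, and suppose that $\Omega_{\mathcal H}\neq\emptyset$. Then the problem of maximizing $\mathcal G$ on the set $\Phi_{\mathcal H}$ is equivalent to the problem of maximizing $E(\gamma_1,\dots,\gamma_n)=\gamma_1+\dots+\gamma_n$ on the set $\Omega_{\mathcal H}$; that is, a point $(\rho_1,\dots,\rho_{n+m})\in\Phi_{\mathcal H}$ maximizes $\mathcal G$ over $\Phi_{\mathcal H}$ if and only if $(f(\rho_1),\dots,f(\rho_n))\in\Omega_{\mathcal H}$ maximizes $E$ over $\Omega_{\mathcal H}$.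
   Context: Flux: $f:[0,1]\to\mathbb R$ is continuous, piecewise smooth, concave, with $f(0)=f(1)=0$, and there is a unique $\sigma\in\,]0,1[$ such that $f$ is strictly increasing on $[0,\sigma[$ and strictly decreasing on $]\sigma,1]$. Let $\tau:[0,1]\to[0,1]$ be the map with $f(\tau(\rho))=f(\rho)$ for all $\rho$ and $\tau(\rho)\ne\rho$ for $\rho\neq\sigma$. Convention: $\mathrm{sgn}(0)=0$. Incoming arcs have indices $1,\dots,n$, outgoing arcs $n+1,\dots,n+m$. Matrices: $\mathcal A$ is the set of real matrices $A=(a_{ji})$, $j=n+1,\dots,n+m$, $i=1,\dots,n$, with $0<a_{ji}<1$ for all $i,j$ and $\sum_{j=n+1}^{n+m}a_{ji}=1$ for all $i$. For $i\le n$ let $H_i=\{e_i\}^\perp\subset\mathbb R^n$ ($e_i$ the canonical basis) and for $j\ge n+1$ let $H_j=\{a_j\}^\perp$ with $a_j=(a_{j1},\dots,a_{jn})$. $\mathcal K$ is the set of ${\bf k}=(k_1,\dots,k_\ell)$ with $1\le\ell\le n-1$ and $1\le k_1<\dots<k_\ell\le n+m$; $H_{\bf k}=\bigcap_{h=1}^\ell H_{k_h}$; and $\mathfrak N=\{A\in\mathcal A:(1,\dots,1)\notin H_{\bf k}^\perp\text{ for every }{\bf k}\in\mathcal K\}$. Sets determined by the initial datum: for $i\le n$, if $\rho_{i,0}\le\sigma$ then $\Omega_i=[0,f(\rho_{i,0})]$ and $\Phi_i=\{\rho_{i,0}\}\cup\,]\tau(\rho_{i,0}),1]$, while if $\rho_{i,0}\ge\sigma$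 then $\Omega_i=[0,f(\sigma)]$ and $\Phi_i=[\sigma,1]$. For $j\ge n+1$, if $\rho_{j,0}\le\sigma$ then $\Omega_j=[0,f(\sigma)]$ and $\Phi_j=[0,\sigma]$, while if $\rho_{j,0}\ge\sigma$ then $\Omega_j=[0,f(\rho_{j,0})]$ and $\Phi_j=\{\rho_{j,0}\}\cup[0,\tau(\rho_{j,0})[$. $\Omega_{\mathcal H}$ is the set of $(\gamma_1,\dots,\gamma_n)\in\prod_{i=1}^n\Omega_i$ such that, setting $(\gamma_{n+1},\dots,\gamma_{n+m})^T=A(\gamma_1,\dots,\gamma_n)^T$, one has $(\gamma_{n+1},\dots,\gamma_{n+m})\in\prod_{j=n+1}^{n+m}\Omega_j$, $\gamma_l=\max\Omega_l$ for $l\in\mathcal H$, and $\gamma_l<\max\Omega_l$ for $l\in\{1,\dots,n+m\}\setminus\mathcal H$. $\Phi_{\mathcal H}$ is the set of $(\rho_1,\dots,\rho_{n+m})\in\prod_{l=1}^{n+m}\Phi_l$ such that $(f(\rho_1),\dots,f(\rho_n))\in\Omega_{\mathcal H}$ and $(f(\rho_{n+1}),\dots,f(\rho_{n+m}))^T=A(f(\rho_1),\dots,f(\rho_n))^T$. The map $(\rho_1,\dots,\rho_{n+m})\mapsto(f(\rho_1),\dots,f(\rho_n))$ is a bijection $\Phi_{\mathcal H}\to\Omega_{\mathcal H}$. $\mathcal G(\rho_1,\dots,\rho_{n+m})=\sum_{i=1}^n\mathrm{sgn}(\rho_i-\sigma)(f(\rho_i)-f(\sigma))-\sum_{j=n+1}^{n+m}\mathrm{sgn}(\rho_j-\sigma)(f(\rho_j)-f(\sigma))$.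 *)

(* Defs.v *)
From HB Require Import structures.
From mathcomp Require Import all_boot all_order all_algebra.
From mathcomp Require Import all_classical all_reals all_analysis.

Set Implicit Arguments.
Unset Strict Implicit.
Unset Printing Implicit Defensive.

Import Order.TTheory GRing.Theory Num.Theory.
Import numFieldNormedType.Exports.

Local Open Scope classical_set_scope.
Local Open Scope ring_scope.

Definition is_max (R : realType) (S : set R) (x : R) : Prop :=
  S x /\ ubound S x.

Definition maximizes (R : realType) (T : Type) (F : T -> R) (S : set T) (x : T)
  : Prop :=
  S x /\ forall y, S y -> F y <= F x.

Definition smooth (R : realType) (g : R -> R) : Prop :=
  forall (k : nat) (x : R), derivable (derive1n k g : R -> R) x 1.

(* On every closed piece [x_k, x_(k+1)] of a finite partition
   a = x_0 < x_1 < ... < x_N = b, with x_1, ..., x_N listed in s,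
   f is the restriction of a smooth function. *)
Definition piecewise_smooth (R : realType) (a b : R) (f : R -> R) : Prop :=
  exists s : seq R, itv_partition a b s /\
    forall k : nat, (k < size s)%N ->
      exists2 g : R -> R, smooth g &
        {in `[nth b (a :: s) k, nth b s k], f =1 g}.

Definition concave_on (R : realType) (D : set R) (f : R -> R) : Prop :=
  @convex_function R R^o D (fun x => - f x).

Definition flux_peak (R : realType) (f : R -> R) (sigma : R) : Prop :=
  [/\ 0 < sigma < 1,
      {in `[0, sigma[ &, {homo f : x y / x < y}} &
      {in `]sigma, 1] &, {homo f : x y / x < y >-> y < x}}].

(* A flux on [0, 1] is represented by a function on R whose values outside
   [0, 1] are irrelevant; the same convention is used for tau below. *)
Record is_flux (R : realType) (f : R -> R) : Prop := IsFlux {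
  flux_continuous : {within `[0, 1], continuous f} ;
  flux_piecewise_smooth : piecewise_smooth 0 1 f ;
  flux_concave : concave_on `[0, 1] f ;
  flux_at0 : f 0 = 0 ;
  flux_at1 : f 1 = 0 ;
  flux_unique_peak : exists! sigma : R, flux_peak f sigma
}.

Record is_tau (R : realType) (f : R -> R) (sigma : R) (tau : R -> R) : Prop :=
  IsTau {
  tau_range : {in `[0, 1], forall rho, tau rho \in `[0, 1]} ;
  tau_flux : {in `[0, 1], forall rho, f (tau rho) = f rho} ;
  tau_neq : {in `[0, 1], forall rho, rho != sigma -> tau rho != rho}
}.

(* Throughout, the arcs are indexed by 'I_(n + m): lshift m i is the i-th
   incoming arc and rshift n j is the j-th outgoing arc. *)

Definition distribution_matrix (R : realType) (n m : nat) (A : 'M[R]_(m, n))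
  : Prop :=
  (forall j i, 0 < A j i < 1) /\ (forall i, \sum_(j < m) A j i = 1).

Definition dotp (R : realType) (n : nat) (u v : 'rV[R]_n) : R :=
  \sum_(i < n) u 0 i * v 0 i.

Definition orthogonal_compl (R : realType) (n : nat) (S : set 'rV[R]_n)
  : set 'rV[R]_n :=
  [set v | forall w, S w -> dotp v w = 0].

Definition arc_normal (R : realType) (n m : nat) (A : 'M[R]_(m, n))
  (l : 'I_(n + m)) : 'rV[R]_n :=
  match fintype.split l with
  | inl i => delta_mx 0 i
  | inr j => row j A
  end.

Definition arc_hyperplane (R : realType) (n m : nat) (A : 'M[R]_(m, n))
  (l : 'I_(n + m)) : set 'rV[R]_n :=
  orthogonal_compl [set arc_normal A l].

Definition generic_matrix (R : realType) (n m : nat) (A : 'M[R]_(m, n))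
  : Prop :=
  distribution_matrix A /\
  forall (l : nat) (k : l.-tuple 'I_(n + m)),
    (1 <= l <= n - 1)%N -> sorted ltn [seq val i | i <- k] ->
    ~ orthogonal_compl (\bigcap_(h in [set: 'I_l]) arc_hyperplane A (tnth k h))
        (const_mx 1).

(* In the next four definitions the cases rho0 <= sigma and rho0 >= sigma
   prescribe the same set at rho0 = sigma, because tau sigma = sigma. *)

Definition Omega_in (R : realType) (f : R -> R) (sigma rho0 : R) : set R :=
  if rho0 <= sigma then `[0, f rho0]%classic else `[0, f sigma]%classic.

Definition Phi_in (R : realType) (sigma : R) (tau : R -> R) (rho0 : R)
  : set R :=
  if rho0 <= sigma then [set rho0] `|` `]tau rho0, 1]%classic
  else `[sigma, 1]%classic.

Definition Omega_out (R : realType) (f : R -> R) (sigma rho0 : R) : set R :=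
  if rho0 <= sigma then `[0, f sigma]%classic else `[0, f rho0]%classic.

Definition Phi_out (R : realType) (sigma : R) (tau : R -> R) (rho0 : R)
  : set R :=
  if rho0 <= sigma then `[0, sigma]%classic
  else [set rho0] `|` `[0, tau rho0[%classic.

Definition Omega (R : realType) (n m : nat) (f : R -> R) (sigma : R)
  (rho0 : 'cV[R]_(n + m)) (l : 'I_(n + m)) : set R :=
  match fintype.split l with
  | inl _ => Omega_in f sigma (rho0 l 0)
  | inr _ => Omega_out f sigma (rho0 l 0)
  end.

Definition Phi (R : realType) (n m : nat) (sigma : R) (tau : R -> R)
  (rho0 : 'cV[R]_(n + m)) (l : 'I_(n + m)) : set R :=
  match fintype.split l with
  | inl _ => Phi_in sigma tau (rho0 l 0)
  | inr _ => Phi_out sigma tau (rho0 l 0)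
  end.

Definition all_fluxes (R : realType) (n m : nat) (A : 'M[R]_(m, n))
  (gamma : 'cV[R]_n) : 'cV[R]_(n + m) :=
  col_mx gamma (A *m gamma).

Definition Omega_set (R : realType) (n m : nat) (f : R -> R) (sigma : R)
  (A : 'M[R]_(m, n)) (rho0 : 'cV[R]_(n + m)) (H : {set 'I_(n + m)})
  : set 'cV[R]_n :=
  [set gamma : 'cV[R]_n |
    [/\ forall l, Omega f sigma rho0 l (all_fluxes A gamma l 0),
        forall l, l \in H ->
          is_max (Omega f sigma rho0 l) (all_fluxes A gamma l 0) &
        forall l, l \notin H ->
          exists2 M, is_max (Omega f sigma rho0 l) M &
            all_fluxes A gamma l 0 < M]].

Definition in_fluxes (R : realType) (n m : nat) (f : R -> R)
  (rho : 'cV[R]_(n + m)) : 'cV[R]_n :=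
  \col_(i < n) f (rho (lshift m i) 0).

Definition out_fluxes (R : realType) (n m : nat) (f : R -> R)
  (rho : 'cV[R]_(n + m)) : 'cV[R]_m :=
  \col_(j < m) f (rho (rshift n j) 0).

Definition Phi_set (R : realType) (n m : nat) (f : R -> R) (sigma : R)
  (tau : R -> R) (A : 'M[R]_(m, n)) (rho0 : 'cV[R]_(n + m))
  (H : {set 'I_(n + m)}) : set 'cV[R]_(n + m) :=
  [set rho : 'cV[R]_(n + m) |
    [/\ forall l, Phi sigma tau rho0 l (rho l 0),
        Omega_set f sigma A rho0 H (in_fluxes f rho) &
        out_fluxes f rho = A *m in_fluxes f rho]].

Definition entropy_functional (R : realType) (n m : nat) (f : R -> R)
  (sigma : R) (rho : 'cV[R]_(n + m)) : R :=
  \sum_(i < n) Num.sg (rho (lshift m i) 0 - sigma) *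
                 (f (rho (lshift m i) 0) - f sigma)
  - \sum_(j < m) Num.sg (rho (rshift n j) 0 - sigma) *
                   (f (rho (rshift n j) 0) - f sigma).

Definition total_flux (R : realType) (n : nat) (gamma : 'cV[R]_n) : R :=
  \sum_(i < n) gamma i 0.

(* Main.v *)
Require Import Defs.
From mathcomp Require Import all_boot all_order all_algebra.
From mathcomp Require Import all_classical all_reals all_analysis.
From mathcomp Require Import lra.

Import Order.TTheory GRing.Theory Num.Theory.
Import numFieldNormedType.Exports.

(** On Phi_H the functional G is an increasing affine function of E:
    G(rho) = 2 E(f(rho_1), ..., f(rho_n)) + C, with C depending on H and on the
    initial datum but not on rho.  The equivalence follows from this identity
    as soon as every point of Omega_H comes from a point of Phi_H.

    The identity is found arc by arc.  Write s_l for the entropy of arc l, that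
    is sgn(rho_l - sigma) (f(rho_l) - f(sigma)), counted with a plus sign on an
    incoming arc and a minus sign on an outgoing one.  Leaving aside the initial
    density, the set Phi_l lies in the branch of f (rho >= sigma for an incoming
    arc, rho <= sigma for an outgoing one) on which s_l = f(rho_l) - f(sigma).
    The initial density may lie in the other branch, but it then carries the
    flux max Omega_l, which no other point of Phi_l does: so it occurs exactly
    when l belongs to H, and s_l is then a constant
    ([Phi_in_entropy], [Phi_out_entropy]).  In H the flux f(rho_l) is itself
    constant, so in all cases s_l = f(rho_l) + c_l ([Phi_set_arc_entropy]).
    Summing over l gives the total flux through all arcs, up to a constant; as
    the columns of A sum to 1, what leaves the junction equals what enters it,
    whence the factor 2 ([sum_all_fluxes], [entropy_functional_affine]).

    Surjectivity of Phi_H -> Omega_H ([in_fluxes_surj]) is the intermediate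
    value theorem on each branch.  The facts about tau rest on the strict
    monotonicity of f up to and including the peak sigma, which the definition
    of a peak gives only away from sigma and continuity extends. *)

Local Open Scope classical_set_scope.
Local Open Scope ring_scope.

(** * The two strictly monotone branches of the flux *)

Lemma flux_within_continuous {R : realType} {f : R -> R} {a b : R} :
  is_flux f -> 0 <= a -> b <= 1 -> {within `[a, b], continuous f}.
Proof.
move=> hf a0 b1; apply: continuous_subspaceW (flux_continuous hf).
by apply: subset_itv; rewrite bnd_simp.
Qed.

(** Monotonicity passes to the closed branch because f(sigma) is the limit of
    f(z) as z increases to sigma, and these values eventually exceed
    f((x + sigma) / 2), itself larger than f(x). *)
Lemma flux_increasing {R : realType} {f : R -> R} {sigma : R} :
  is_flux f -> flux_peak f sigma ->
  forall x y, 0 <= x -> x < y -> y <= sigma -> f x < f y.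
Proof.
move=> hf [/andP[s0 s1] finc _] x y x0 xy.
rewrite le_eqVlt => /orP[/eqP ys|ys]; last first.
  by apply: finc; rewrite ?in_itv/= //; apply/andP; split; lra.
rewrite {y}ys in xy *.
have [_ _ fs] : [/\ {in `]0, sigma[%R, continuous f}, f z @[z --> 0^'+] --> f 0
  & f z @[z --> sigma^'-] --> f sigma].
  apply/(continuous_within_itvP _ s0).
  by apply: flux_within_continuous; rewrite // ltW.
pose w := (x + sigma) / 2.
apply: (@lt_le_trans _ _ (f w)).
  by apply: finc; rewrite ?in_itv/= /w; try (apply/andP; split); lra.
apply: (cvgr_to_ge fs); near=> z.
apply/ltW/finc; rewrite ?in_itv/=.
- by rewrite /w; apply/andP; split; lra.
- apply/andP; split; last by near: z; exact: nbhs_left_lt.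
  by apply/ltW; near: z; apply: nbhs_left_gt.
- by near: z; apply: nbhs_left_gt; rewrite /w; lra.
Unshelve. all: by end_near. Qed.

Lemma flux_decreasing {R : realType} {f : R -> R} {sigma : R} :
  is_flux f -> flux_peak f sigma ->
  forall x y, sigma <= x -> x < y -> y <= 1 -> f y < f x.
Proof.
move=> hf [/andP[s0 s1] _ fdec] x y + xy y1.
rewrite le_eqVlt => /orP[/eqP sx|sx]; last first.
  by apply: fdec; rewrite ?in_itv/= //; apply/andP; split; lra.
rewrite -{x}sx in xy *.
have [_ fs _] : [/\ {in `]sigma, 1[%R, continuous f},
  f z @[z --> sigma^'+] --> f sigma & f z @[z --> 1^'-] --> f 1].
  apply/(continuous_within_itvP _ s1).
  by apply: flux_within_continuous; rewrite // ltW.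
pose w := (y + sigma) / 2.
apply: (@lt_le_trans _ _ (f w)).
  by apply: fdec; rewrite ?in_itv/= /w; try (apply/andP; split); lra.
apply: (cvgr_to_ge fs); near=> z.
apply/ltW/fdec; rewrite ?in_itv/=.
- apply/andP; split; first by near: z; exact: nbhs_right_gt.
  by apply/ltW; near: z; apply: nbhs_right_lt.
- by rewrite /w; apply/andP; split; lra.
- by near: z; apply: nbhs_right_lt; rewrite /w; lra.
Unshelve. all: by end_near. Qed.

(** Two points of [0, sigma] with the same flux coincide, so tau can only keep
    the flux by crossing sigma.  At the peak itself the same argument, with
    [flux_tau_le], forces tau(sigma) = sigma. *)
Lemma flux_tau_ge {R : realType} {f : R -> R} {sigma : R} {tau : R -> R} :
  is_flux f -> flux_peak f sigma -> is_tau f sigma tau ->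
  forall rho, 0 <= rho <= sigma -> sigma <= tau rho <= 1.
Proof.
move=> hf hs htau rho /andP[r0 rs].
have [/andP[s0 s1] _ _] := hs.
have r01 : rho \in `[0, 1] by rewrite in_itv/=; apply/andP; split; lra.
have := tau_range htau r01; rewrite in_itv/= => /andP[t0 ->]; rewrite andbT.
rewrite leNgt; apply/negP => ts; have ft := tau_flux htau r01.
have [tr|rt|tr] := ltgtP (tau rho) rho.
- by have := flux_increasing hf hs _ _ t0 tr rs; rewrite ft ltxx.
- by have := flux_increasing hf hs _ _ r0 rt (ltW ts); rewrite ft ltxx.
- have rneq : rho != sigma by rewrite -tr lt_eqF.
  by have /eqP := tau_neq htau r01 rneq.
Qed.

Lemma flux_tau_le {R : realType} {f : R -> R} {sigma : R} {tau : R -> R} :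
  is_flux f -> flux_peak f sigma -> is_tau f sigma tau ->
  forall rho, sigma <= rho <= 1 -> 0 <= tau rho <= sigma.
Proof.
move=> hf hs htau rho /andP[rs r1].
have [/andP[s0 s1] _ _] := hs.
have r01 : rho \in `[0, 1] by rewrite in_itv/=; apply/andP; split; lra.
have := tau_range htau r01; rewrite in_itv/= => /andP[-> t1].
rewrite leNgt; apply/negP => ts; have ft := tau_flux htau r01.
have [tr|rt|tr] := ltgtP (tau rho) rho.
- by have := flux_decreasing hf hs _ _ (ltW ts) tr r1; rewrite ft ltxx.
- by have := flux_decreasing hf hs _ _ rs rt t1; rewrite ft ltxx.
- have rneq : rho != sigma by rewrite -tr gt_eqF.
  by have /eqP := tau_neq htau r01 rneq.
Qed.

(** * A single arc: density, flux and entropy *)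

Definition flux_entropy {R : realType} (f : R -> R) (sigma rho : R) : R :=
  Num.sg (rho - sigma) * (f rho - f sigma).

(** The right end point of [Omega_in].  Putting the case distinction inside f
    shows it as the flux of one density, the initial one or the peak. *)
Definition capacity_in {R : realType} (f : R -> R) (sigma rho0 : R) : R :=
  f (if rho0 <= sigma then rho0 else sigma).

Definition capacity_out {R : realType} (f : R -> R) (sigma rho0 : R) : R :=
  f (if rho0 <= sigma then sigma else rho0).

(** The entropy of an arc is a function of its flux alone.  Congested densities
    rho >= sigma have sign 1, or a vanishing second factor at sigma.  The only
    other candidate is rho0 < sigma: the remaining densities lie beyond
    tau(rho0), where f is strictly below f(rho0), so the flux
    f(rho0) = max Omega singles out rho0. *)
Lemma Phi_in_entropy {R : realType} {f : R -> R} {sigma : R} {tau : R -> R} :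
  is_flux f -> flux_peak f sigma -> is_tau f sigma tau ->
  forall rho0, 0 <= rho0 <= 1 -> exists c, forall rho,
    Phi_in sigma tau rho0 rho ->
    flux_entropy f sigma rho =
      if f rho == capacity_in f sigma rho0 then c else f rho - f sigma.
Proof.
move=> hf hs htau rho0 /andP[r0 r1]; rewrite /Phi_in /capacity_in.
case: (leP rho0 sigma) => rs.
  exists (flux_entropy f sigma rho0) => rho [->|/=]; first by rewrite eqxx.
  rewrite in_itv/= => /andP[tr rho1].
  have /andP[st t1] : sigma <= tau rho0 <= 1.
    by apply: (flux_tau_ge hf hs htau); rewrite r0 rs.
  have := flux_decreasing hf hs _ _ st tr rho1.
  rewrite (tau_flux htau) ?in_itv/= ?r0// => frho.
  rewrite lt_eqF// /flux_entropy gtr0_sg ?mul1r//.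
  by rewrite subr_gt0 (le_lt_trans st).
exists 0 => rho /=; rewrite in_itv/= => /andP[srho rho1].
rewrite /flux_entropy; case: eqP => [->|fneq]; first by rewrite subrr mulr0.
rewrite gtr0_sg ?mul1r// subr_gt0 lt_neqAle srho andbT.
by apply/eqP => srho'; apply: fneq; rewrite srho'.
Qed.

(** The mirror image of [Phi_in_entropy]: free densities rho <= sigma have sign
    -1, which the minus sign in front of the outgoing arcs compensates. *)
Lemma Phi_out_entropy {R : realType} {f : R -> R} {sigma : R} {tau : R -> R} :
  is_flux f -> flux_peak f sigma -> is_tau f sigma tau ->
  forall rho0, 0 <= rho0 <= 1 -> exists c, forall rho,
    Phi_out sigma tau rho0 rho ->
    - flux_entropy f sigma rho =
      if f rho == capacity_out f sigma rho0 then c else f rho - f sigma.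
Proof.
move=> hf hs htau rho0 /andP[r0 r1]; rewrite /Phi_out /capacity_out.
case: (leP rho0 sigma) => rs.
  exists 0 => rho /=; rewrite in_itv/= => /andP[rho0' rhos].
  rewrite /flux_entropy; case: eqP => [->|fneq].
    by rewrite subrr mulr0 oppr0.
  rewrite ltr0_sg ?mulN1r ?opprK// subr_lt0 lt_neqAle rhos andbT.
  by apply/eqP => rhos'; apply: fneq; rewrite rhos'.
exists (- flux_entropy f sigma rho0) => rho [->|/=]; first by rewrite eqxx.
rewrite in_itv/= => /andP[rho0' rt].
have /andP[t0 ts] : 0 <= tau rho0 <= sigma.
  by apply: (flux_tau_le hf hs htau); rewrite r1 ltW.
have := flux_increasing hf hs _ _ rho0' rt ts.
rewrite (tau_flux htau) ?in_itv/= ?r0// => frho.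
rewrite lt_eqF// /flux_entropy ltr0_sg ?mulN1r ?opprK//.
by rewrite subr_lt0 (lt_le_trans rt).
Qed.

(** The decreasing branch from any a in [sigma, 1] takes every value from f(a)
    down to f(1) = 0.  It is used with a = sigma, or with a = tau(rho0); the
    latter end point is excluded from the set, but its flux f(rho0) is attained
    at rho0. *)
Lemma Phi_in_flux_surj {R : realType} {f : R -> R} {sigma : R} {tau : R -> R} :
  is_flux f -> flux_peak f sigma -> is_tau f sigma tau ->
  forall rho0, 0 <= rho0 <= 1 -> forall y, 0 <= y <= capacity_in f sigma rho0 ->
  exists2 rho, Phi_in sigma tau rho0 rho & f rho = y.
Proof.
move=> hf hs htau rho0 /andP[r0 r1] y; rewrite /Phi_in /capacity_in.
have [/andP[s0 s1] _ _] := hs.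
have branch a : sigma <= a <= 1 -> 0 <= y <= f a ->
    exists2 rho, rho \in `[a, 1] & f rho = y.
  move=> /andP[sa a1] /andP[y0 yf]; apply: IVT => //.
    by apply: flux_within_continuous => //; lra.
  by rewrite (flux_at1 hf) ge_min le_max y0 yf orbT.
case: (leP rho0 sigma) => rs; last first.
  by move=> yb; apply: branch; rewrite // lexx ltW.
move=> /andP[y0]; rewrite le_eqVlt => /orP[/eqP ->|yf].
  by exists rho0 => //; left.
have tau1 : sigma <= tau rho0 <= 1.
  by apply: (flux_tau_ge hf hs htau); rewrite r0 rs.
have ft : f (tau rho0) = f rho0 by rewrite (tau_flux htau)// in_itv/= r0.
have [|rho] := branch _ tau1; first by rewrite ft y0 ltW.
rewrite in_itv/= => /andP[trho rho1] frho; exists rho => //; right.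
rewrite /= in_itv/= rho1 andbT lt_neqAle trho andbT.
by apply/eqP => trho'; rewrite -frho -ft trho' ltxx in yf.
Qed.

Lemma Phi_out_flux_surj {R : realType} {f : R -> R} {sigma : R} {tau : R -> R} :
  is_flux f -> flux_peak f sigma -> is_tau f sigma tau ->
  forall rho0, 0 <= rho0 <= 1 -> forall y, 0 <= y <= capacity_out f sigma rho0 ->
  exists2 rho, Phi_out sigma tau rho0 rho & f rho = y.
Proof.
move=> hf hs htau rho0 /andP[r0 r1] y; rewrite /Phi_out /capacity_out.
have [/andP[s0 s1] _ _] := hs.
have branch b : 0 <= b <= sigma -> 0 <= y <= f b ->
    exists2 rho, rho \in `[0, b] & f rho = y.
  move=> /andP[b0 bs] /andP[y0 yf]; apply: IVT => //.
    by apply: flux_within_continuous => //; lra.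
  by rewrite (flux_at0 hf) ge_min le_max y0 yf orbT.
case: (leP rho0 sigma) => rs.
  by move=> yb; apply: branch; rewrite // lexx ltW.
move=> /andP[y0]; rewrite le_eqVlt => /orP[/eqP ->|yf].
  by exists rho0 => //; left.
have tau0 : 0 <= tau rho0 <= sigma.
  by apply: (flux_tau_le hf hs htau); rewrite r1 ltW.
have ft : f (tau rho0) = f rho0 by rewrite (tau_flux htau)// in_itv/= r0.
have [|rho] := branch _ tau0; first by rewrite ft y0 ltW.
rewrite in_itv/= => /andP[rho00 rhot] frho; exists rho => //; right.
rewrite /= in_itv/= rho00 lt_neqAle rhot andbT.
by apply/eqP => rhot'; rewrite -frho -ft rhot' ltxx in yf.
Qed.

(** * The junction: entropy as an affine function of the total flux *)

Definition capacity {R : realType} {n m : nat} (f : R -> R) (sigma : R)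
  (rho0 : 'cV[R]_(n + m)) (l : 'I_(n + m)) : R :=
  match fintype.split l with
  | inl _ => capacity_in f sigma (rho0 l 0)
  | inr _ => capacity_out f sigma (rho0 l 0)
  end.

Lemma OmegaE {R : realType} {n m : nat} (f : R -> R) (sigma : R)
  (rho0 : 'cV[R]_(n + m)) (l : 'I_(n + m)) :
  Omega f sigma rho0 l = `[0, capacity f sigma rho0 l]%classic.
Proof.
rewrite /Omega /capacity /Omega_in /Omega_out /capacity_in /capacity_out.
by case: fintype.split => _; case: ifP.
Qed.

Lemma is_max_Omega {R : realType} {n m : nat} {f : R -> R} {sigma : R}
  {rho0 : 'cV[R]_(n + m)} {l : 'I_(n + m)} {x : R} :
  is_max (Omega f sigma rho0 l) x -> x = capacity f sigma rho0 l.
Proof.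
rewrite OmegaE => -[]; rewrite /= in_itv/= => /andP[x0 xc] xub.
apply/eqP; rewrite eq_le xc; apply: xub.
by rewrite /= in_itv/= lexx (le_trans x0).
Qed.

(** Carrying the sign of the arc inside the definition turns the two sums of the
    entropy functional into a single sum over all arcs. *)
Definition arc_entropy {R : realType} {n m : nat} (f : R -> R) (sigma : R)
  (l : 'I_(n + m)) (rho : R) : R :=
  match fintype.split l with
  | inl _ => flux_entropy f sigma rho
  | inr _ => - flux_entropy f sigma rho
  end.

Lemma entropy_functionalE {R : realType} {n m : nat} (f : R -> R) (sigma : R)
  (rho : 'cV[R]_(n + m)) :
  @entropy_functional R n m f sigma rho =
  \sum_l arc_entropy f sigma l (rho l 0).
Proof.
rewrite big_split_ord /= /entropy_functional -sumrN.
congr (_ + _); apply: eq_bigr => k _; rewrite /arc_entropy.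
  by rewrite (unsplitK (inl k)).
by rewrite (unsplitK (inr k)).
Qed.

(** Conservation of mass at the junction: each incoming unit of flux is counted
    once on its own arc and once, through its column of A, on the outgoing
    ones. *)
Lemma sum_all_fluxes {R : realType} {n m : nat} {A : 'M[R]_(m, n)} :
  distribution_matrix A -> forall gamma : 'cV[R]_n,
  \sum_l all_fluxes A gamma l 0 = 2 * total_flux gamma.
Proof.
move=> [_ A1] gamma; rewrite big_split_ord /= mulr2n mulrDl mul1r.
congr (_ + _).
  by apply: eq_bigr => i _; rewrite col_mxEu.
under eq_bigr do rewrite col_mxEd mxE.
rewrite exchange_big; apply: eq_bigr => i _.
by rewrite -mulr_suml A1 mul1r.
Qed.

Lemma Phi_set_fluxes {R : realType} {n m : nat} {f : R -> R} {sigma : R}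
  {tau : R -> R} {A : 'M[R]_(m, n)} {rho0 : 'cV[R]_(n + m)}
  {H : {set 'I_(n + m)}} {rho : 'cV[R]_(n + m)} :
  Phi_set f sigma tau A rho0 H rho ->
  forall l, all_fluxes A (in_fluxes f rho) l 0 = f (rho l 0).
Proof.
move=> [_ _ outE] l; rewrite /all_fluxes -outE.
by case: (split_ordP l) => k ->; rewrite ?col_mxEu ?col_mxEd mxE.
Qed.

(** Membership of l in H decides whether the flux of arc l equals max Omega_l,
    that is, which case of [Phi_in_entropy] or [Phi_out_entropy] applies.  For l
    in H both the entropy and the flux are constant and c is their difference;
    otherwise c = - f(sigma). *)
Lemma Phi_set_arc_entropy {R : realType} {n m : nat} {f : R -> R} {sigma : R}
  {tau : R -> R} (hf : is_flux f) (hsigma : flux_peak f sigma)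
  (htau : is_tau f sigma tau) (A : 'M[R]_(m, n)) {rho0 : 'cV[R]_(n + m)}
  (hrho0 : forall l, 0 <= rho0 l 0 <= 1) (H : {set 'I_(n + m)})
  (l : 'I_(n + m)) :
  exists c, forall rho, Phi_set f sigma tau A rho0 H rho ->
    arc_entropy f sigma l (rho l 0) = f (rho l 0) + c.
Proof.
have [c0 c0P] : exists c, forall rho, Phi sigma tau rho0 l rho ->
    arc_entropy f sigma l rho =
      if f rho == capacity f sigma rho0 l then c else f rho - f sigma.
  rewrite /Phi /arc_entropy /capacity; case: fintype.split => _.
    exact: Phi_in_entropy.
  exact: Phi_out_entropy.
exists (if l \in H then c0 - capacity f sigma rho0 l else - f sigma) => rho rhoP.
have [rhoPhi [_ sat unsat] _] := rhoP.
rewrite c0P; last exact: rhoPhi.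
case: (boolP (l \in H)) => lH.
  by rewrite -(Phi_set_fluxes rhoP) (is_max_Omega (sat l lH)) eqxx addrC subrK.
have [M /is_max_Omega ->] := unsat l lH.
by rewrite (Phi_set_fluxes rhoP) => /lt_eqF ->.
Qed.

Lemma entropy_functional_affine {R : realType} {n m : nat} {f : R -> R}
  {sigma : R} {tau : R -> R} (hf : is_flux f) (hsigma : flux_peak f sigma)
  (htau : is_tau f sigma tau) {A : 'M[R]_(m, n)}
  (hA : distribution_matrix A) {rho0 : 'cV[R]_(n + m)}
  (hrho0 : forall l, 0 <= rho0 l 0 <= 1) (H : {set 'I_(n + m)}) :
  exists C, forall rho, Phi_set f sigma tau A rho0 H rho ->
    entropy_functional f sigma rho = 2 * total_flux (in_fluxes f rho) + C.
Proof.
have [c cP] := choice (Phi_set_arc_entropy hf hsigma htau A hrho0 H).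
exists (\sum_l c l) => rho rhoP.
rewrite entropy_functionalE -(sum_all_fluxes hA) -big_split /=.
by apply: eq_bigr => l _; rewrite (cP l rho rhoP) (Phi_set_fluxes rhoP).
Qed.

Lemma in_fluxes_surj {R : realType} {n m : nat} {f : R -> R}
  {sigma : R} {tau : R -> R} (hf : is_flux f) (hsigma : flux_peak f sigma)
  (htau : is_tau f sigma tau) {A : 'M[R]_(m, n)} {rho0 : 'cV[R]_(n + m)}
  (hrho0 : forall l, 0 <= rho0 l 0 <= 1) {H : {set 'I_(n + m)}}
  {gamma : 'cV[R]_n} :
  Omega_set f sigma A rho0 H gamma ->
  exists2 rho, Phi_set f sigma tau A rho0 H rho & in_fluxes f rho = gamma.
Proof.
move=> gammaP; have [gammaO _ _] := gammaP.
have /choice[r rP] : forall l, exists r,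
    Phi sigma tau rho0 l r /\ f r = all_fluxes A gamma l 0.
  move=> l; have := gammaO l; rewrite OmegaE /= in_itv/= /Phi /capacity => gl.
  case: fintype.split gl => _ gl.
    have [r] := Phi_in_flux_surj hf hsigma htau _ (hrho0 l) _ gl.
    by exists r.
  have [r] := Phi_out_flux_surj hf hsigma htau _ (hrho0 l) _ gl.
  by exists r.
have inE : in_fluxes f (\col_l r l) = gamma.
  by apply/colP => i; rewrite !mxE (rP _).2 col_mxEu.
exists (\col_l r l) => //; split; rewrite ?inE//.
  by move=> l; rewrite mxE; exact: (rP l).1.
by apply/colP => j; rewrite !mxE (rP _).2 col_mxEd mxE.
Qed.

Theorem corollary5p1 (R : realType) (n m : nat) (hn : (1 <= n)%N)
  (hm : (1 <= m)%N) (f : R -> R) (sigma : R) (tau : R -> R)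
  (hf : is_flux f) (hsigma : flux_peak f sigma) (htau : is_tau f sigma tau)
  (A : 'M[R]_(m, n)) (hA : generic_matrix A)
  (rho0 : 'cV[R]_(n + m)) (hrho0 : forall l, rho0 l 0 \in `[0, 1])
  (H : {set 'I_(n + m)}) (hH : (#|H| <= n - 1)%N)
  (hOmega : Omega_set f sigma A rho0 H !=set0) :
  forall rho : 'cV[R]_(n + m), Phi_set f sigma tau A rho0 H rho ->
    (maximizes (@entropy_functional R n m f sigma)
       (Phi_set f sigma tau A rho0 H) rho
     <->
     maximizes (@total_flux R n) (Omega_set f sigma A rho0 H)
       (in_fluxes f rho)).
Proof.
move=> rho rhoP.
have r01 l : 0 <= rho0 l 0 <= 1 by have := hrho0 l; rewrite in_itv.
have [C GE] := entropy_functional_affine hf hsigma htau hA.1 r01 H.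
have le_G rho' : Phi_set f sigma tau A rho0 H rho' ->
    (entropy_functional f sigma rho' <= entropy_functional f sigma rho) =
    (total_flux (in_fluxes f rho') <= total_flux (in_fluxes f rho)).
  by move=> rhoP'; rewrite !GE// lerD2r ler_pM2l.
split=> -[_ rho_max]; split.
- by case: rhoP.
- move=> gamma /(in_fluxes_surj hf hsigma htau r01)[rho' rhoP' <-].
  by rewrite -le_G//; exact: rho_max.
- exact: rhoP.
- by move=> rho' rhoP'; rewrite le_G//; apply: rho_max; case: rhoP'.
Qed.
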